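(* Let $n\ge 1$. For every permutation $\sigma\in S_{2n}$ and every Dyck path $D\in\mathcal{D}_n$, the $\sigma$-path $\sigma(D)$ is a Dyck path of size $n$, i.e. $\sigma(D)\in\mathcal{D}_n$.
   Context: A Dyck path of size $n$ is a word $P=P_1P_2\cdots P_{2n}$ in the letters $\mathtt{u},\mathtt{d}$ containing $n$ of each letter such that every prefix contains at least as many $\mathtt{u}$'s as $\mathtt{d}$'s; $\mathcal{D}_n$ denotes the set of Dyck paths of size $n$. For $m\ge1$, $[m]=\{1,\dots,m\}$. The tunneling of $D\in\mathcal{D}_n$ is the fixed-point-free involution $\tau_D\in S_{2n}$ that pairs each up-step position $i$ with the position of its matching down-step (i.e. $\tau_D(i)$ is the smallest $j>i$ such that $D_i\cdots D_j$ contains equally many $\mathtt{u}$'s and $\mathtt{d}$'s), and vice versa. For $\sigma\in S_{2n}$ write $\sigma_k=\sigma(k)$ and $\sigma_{[k]}=\{\sigma_1,\dots,\sigma_k\}$. The $\sigma$-path of $D$ is the word $\sigma(D)$ of length $2n$ with $\sigma(D)_k=\mathtt{u}$ if $\tau_D(\sigma_k)\notin\sigma_{[k]}$ and $\sigma(D)_k=\mathtt{d}$ otherwise. *)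

(* Defs.v *)
From HB Require Import structures.
From mathcomp Require Import all_boot all_fingroup.
From mathcomp Require Import zify.

Set Implicit Arguments.
Unset Strict Implicit.
Unset Printing Implicit Defensive.

Inductive step : Type := Up | Down.

Definition bool_of_step (x : step) : bool := if x is Up then true else false.
Definition step_of_bool (b : bool) : step := if b then Up else Down.

Lemma bool_of_stepK : cancel bool_of_step step_of_bool.
Proof. by case. Qed.

HB.instance Definition _ := Finite.copy step (can_type bool_of_stepK).

Definition Dyck (n : nat) : {set (2 * n).-tuple step} :=
  [set P : (2 * n).-tuple step |
    [&& count_mem Up P == n, count_mem Down P == n
      & [forall k : 'I_(2 * n).+1,
           count_mem Down (take k P) <= count_mem Up (take k P)]]].

(* Positions are numbered from 0 throughout, so [m] is rendered as 'I_m and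
   the factor D_i ... D_j is drop i (take j.+1 D). *)
Section Tunneling.

Variables (n : nat) (D : (2 * n).-tuple step).
Implicit Types i j k : 'I_(2 * n).

Definition balanced i j : bool :=
  count_mem Up (drop i (take j.+1 D)) == count_mem Down (drop i (take j.+1 D)).

Definition matching i j : bool :=
  [&& tnth D i == Up, i < j, balanced i j
    & [forall k : 'I_(2 * n), (i < k) && (k < j) ==> ~~ balanced i k]].

(* The fallback value i is never used when D is a Dyck path: see
   tunnel_matching, tunnelK and tunnel_neq below. *)
Definition tunnel i : 'I_(2 * n) :=
  odflt i (if tnth D i == Up then [pick j | matching i j]
           else [pick j | matching j i]).

End Tunneling.

Definition sigma_prefix (n : nat) (s : 'S_(2 * n)) (k : 'I_(2 * n)) :
    {set 'I_(2 * n)} :=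
  [set s j | j : 'I_(2 * n) & j <= k].

Definition sigma_path (n : nat) (s : 'S_(2 * n)) (D : (2 * n).-tuple step) :
    (2 * n).-tuple step :=
  [tuple if tunnel D (s k) \notin sigma_prefix s k then Up else Down
     | k < 2 * n].

Section TunnelingFacts.

Variables (n : nat) (D : (2 * n).-tuple step).
Implicit Types i j k : 'I_(2 * n).

Let U (k : nat) := count_mem Up (take k D).
Let W (k : nat) := count_mem Down (take k D).

Let stepUW i : (U i.+1 = U i + (tnth D i == Up)) *
               (W i.+1 = W i + (tnth D i != Up)).
Proof.
rewrite /U /W (take_nth (tnth D i)) ?size_tuple ?ltn_ord //.
by rewrite -!cats1 !count_cat -!tnth_nth /= !addn0; case: (tnth D i).
Qed.

Let balancedE i j : i <= j ->
  balanced D i j = (U j.+1 + W i == W j.+1 + U i).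
Proof.
move=> le_ij; rewrite /balanced /U /W.
have -> : take i D = take i (take j.+1 D) by rewrite take_takel //; lia.
set t := take j.+1 D.
have cE x : count_mem x t = count_mem x (take i t) + count_mem x (drop i t).
  by rewrite -count_cat cat_take_drop.
rewrite !cE; lia.
Qed.

Lemma matching_up i j : matching D i j -> tnth D i = Up.
Proof. by case/and4P => /eqP. Qed.

Lemma matching_injr i j j' : matching D i j -> matching D i j' -> j = j'.
Proof.
case/and4P=> _ ij bij /forallP mij /and4P[_ ij' bij' /forallP mij'].
apply/val_inj; case: (ltngtP j j') => //= lt.
  by have := mij' j; rewrite ij lt bij.
by have := mij j'; rewrite ij' lt bij'.
Qed.

Lemma matching_injl i i' j : matching D i j -> matching D i' j -> i = i'.
Proof.
wlog lt : i i' / i < i'.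
  move=> H m m'; apply/val_inj; case: (ltngtP i i') => //= lt.
    by rewrite (H _ _ lt m m').
  by rewrite (H _ _ lt m' m).
case/and4P=> /eqP Di ij bij /forallP mij /and4P[_ ij' bij' _].
move: bij bij'; rewrite !balancedE; [|lia..] => bij bij'.
have [E|ne] := eqVneq (i' : nat) i.+1.
  by have := stepUW i; rewrite Di eqxx /= -E => -[]; lia.
have kP : i'.-1 < 2 * n by have := ltn_ord i'; lia.
have := mij (Ordinal kP); rewrite balancedE /=; last by lia.
have -> : i'.-1.+1 = i' by lia.
lia.
Qed.

Hypothesis DD : D \in Dyck n.

Let UW (k : nat) : W k <= U k.
Proof.
move: DD; rewrite inE => /and3P[_ _ /forallP H].
have [lt|le] := ltnP k (2 * n).+1; first exact: (H (Ordinal lt)).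
have := H ord_max; rewrite /U /W /= !take_oversize // ?size_tuple //; lia.
Qed.

Let UWn : U (2 * n) = W (2 * n).
Proof.
move: DD; rewrite inE => /and3P[/eqP E1 /eqP E2 _].
by rewrite /U /W !take_oversize ?size_tuple // E1 E2.
Qed.

Lemma matching_of_up i : tnth D i = Up ->
  exists2 j, matching D i j & tnth D j = Down.
Proof.
move=> Di.
pose P m := (i <= m) && (U m.+1 + W i <= W m.+1 + U i).
have exP : exists m, P m.
  exists (2 * n).-1; rewrite /P; have := ltn_ord i => lti.
  have -> : (2 * n).-1.+1 = 2 * n by lia.
  rewrite UWn; have := UW i; lia.
case: (ex_minnP exP) => m /andP[le_im leU] minm.
have [sU sW] := stepUW i; rewrite Di eqxx in sU sW.
have lt_im : i < m.
  by rewrite ltn_neqAle le_im andbT; apply/eqP => E; rewrite -E in leU; lia.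
have ltm : m < 2 * n.
  rewrite ltnNge; apply/negP => le2.
  suff /minm : P (2 * n).-1 by have := ltn_ord i; lia.
  rewrite /P; have := ltn_ord i => lti.
  have -> : (2 * n).-1.+1 = 2 * n by lia.
  rewrite UWn; have := UW i; lia.
have Nm (k : nat) : i <= k < m -> W k.+1 + U i < U k.+1 + W i.
  move=> /andP[ik km]; rewrite ltnNge; apply/negP => le.
  suff /minm : P k by lia.
  by rewrite /P ik le.
have := Nm m.-1; have -> : m.-1.+1 = m by lia.
move=> /(_ ltac:(lia)) hm.
have [sUm sWm] := stepUW (Ordinal ltm); rewrite /= in sUm sWm.
exists (Ordinal ltm); last first.
  by case: (tnth D (Ordinal ltm)) sUm sWm => // sUm sWm;
    rewrite eqxx in sUm sWm; lia.
apply/and4P; split; rewrite ?Di //=.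
  by rewrite balancedE /=; [move: sUm sWm; case: eqP => /=; lia|lia].
apply/forallP => k; apply/implyP => /andP[ik km].
rewrite balancedE; last by lia.
have := Nm k; lia.
Qed.

Lemma matching_of_down j : tnth D j = Down -> exists i, matching D i j.
Proof.
move=> Dj; have [sU sW] := stepUW j; rewrite Dj /= in sU sW.
pose P m := (m <= j) && (U m + W j.+1 <= W m + U j.+1).
have exP : exists m, P m.
  have [U0 W0] : U 0 = 0 /\ W 0 = 0 by rewrite /U /W take0.
  by exists 0; rewrite /P U0 W0 !add0n leq0n; apply: UW.
have ubP m : P m -> m <= j by case/andP.
case: (ex_maxnP exP ubP) => m /andP[le_mj leU] maxm.
have lt_mj : m < j.
  rewrite ltn_neqAle le_mj andbT; apply/eqP => E; rewrite E in leU; lia.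
have Nm (k : nat) : m < k <= j -> W k + U j.+1 < U k + W j.+1.
  move=> /andP[mk kj]; rewrite ltnNge; apply/negP => le.
  suff /maxm : P k by lia.
  by rewrite /P kj le.
have ltm : m < 2 * n by have := ltn_ord j; lia.
have [sUm sWm] := stepUW (Ordinal ltm); rewrite /= in sUm sWm.
have hm := Nm m.+1 ltac:(lia).
have Dm : tnth D (Ordinal ltm) = Up.
  by case: (tnth D (Ordinal ltm)) sUm sWm => //=; lia.
rewrite Dm eqxx in sUm sWm.
exists (Ordinal ltm); apply/and4P; split; rewrite ?Dm //=.
  by rewrite balancedE /=; lia.
apply/forallP => k; apply/implyP => /= /andP[mk kj].
rewrite balancedE /=; last by lia.
have := Nm k.+1; lia.
Qed.

Lemma tunnel_matching i :
  if tnth D i == Up then matching D i (tunnel D i)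
  else matching D (tunnel D i) i.
Proof.
rewrite /tunnel; case Di : (tnth D i) => /=.
  by case: pickP => //= H; have [j] := matching_of_up Di; rewrite H.
by case: pickP => //= H; have [j] := matching_of_down Di; rewrite H.
Qed.

Lemma matching_down i j : matching D i j -> tnth D j = Down.
Proof.
move=> m; have [j' m' Dj'] := matching_of_up (matching_up m).
by rewrite (matching_injr m m').
Qed.

Lemma tunnel_neq i : tunnel D i != i.
Proof.
have := tunnel_matching i; case: ifP => _ /and4P[_ lt _ _];
  by rewrite -val_eqE /=; lia.
Qed.

Lemma tunnelK : involutive (tunnel D).
Proof.
move=> i; have := tunnel_matching i; have := tunnel_matching (tunnel D i).
case Di : (tnth D i) => /= + m.
  by rewrite (matching_down m) /= => m'; apply: matching_injl m' m.
by rewrite (matching_up m) /= => m'; apply: matching_injr m' m.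
Qed.

End TunnelingFacts.

(* Main.v *)
(* Transport the tunneling along s to the fixed-point-free involution
   t := s^-1 \o tunnel \o s. The k-th step of the sigma-path is up when
   k < t k and down when t k < k, so t maps the down steps injectively to
   strictly earlier up steps, and exchanges the two kinds of steps. *)
Require Import Defs.
From mathcomp Require Import all_boot all_fingroup.
From mathcomp Require Import zify.

(** Prefix counts become cardinalities of sets of positions, which an injection can compare. *)
Lemma count_take_card (T : eqType) (m k : nat) (p : pred T) (P : m.-tuple T) :
  k <= m -> count p (take k P) = #|[set i : 'I_m | (i < k) && p (tnth P i)]|.
Proof.
(* [T] may be empty, so the default letter for [nth] is taken from [P] itself, which requires a
   nonempty tuple. *)
case: m P => [|m] P le_km; first by rewrite tuple0 /= eq_card0 // => -[].
pose x0 := tnth P ord0.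
rewrite -sum1_card (eq_bigl _ _ (fun i => in_set _ i)).
rewrite -sum1_count (big_nth x0) size_takel ?size_tuple //.
rewrite big_nat_cond (eq_bigl (fun i => (i < k) && p (nth x0 P i))); last first.
  by move=> i; case: (ltnP i k) => //= lt_ik; rewrite nth_take.
rewrite (big_nat_widen _ _ m.+1) // big_mkord; apply: eq_bigl => i.
by rewrite (tnth_nth x0) andbAC andbb.
Qed.

Section InvolutionPath.

Variables (n : nat) (t : 'I_(2 * n) -> 'I_(2 * n)).
Hypotheses (tK : involutive t) (t_neq : forall i, t i != i).

Lemma involution_path_Dyck (P : (2 * n).-tuple step) :
  (forall k, tnth P k = if k < t k then Up else Down) -> P \in Dyck n.
Proof.
move=> PE.
have upE k : (tnth P k == Up) = (k < t k) by rewrite PE; case: ifP.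
have downE k : (tnth P k == Down) = (t k < k).
  by have := t_neq k; rewrite PE -val_eqE /=; case: ltngtP.
have countE x : count_mem x P = #|[set i | tnth P i == x]|.
  rewrite -{1}[tval P](@take_oversize _ (2 * n)) ?size_tuple //.
  rewrite count_take_card //.
  by apply: eq_card => i; rewrite !inE ltn_ord.
have UpDown : count_mem Up P = count_mem Down P.
  (* [t] carries the up steps exactly onto the down steps. *)
  rewrite !countE -(card_imset _ (inv_inj tK)); apply: eq_card => i.
  by rewrite -{1}(tK i) mem_imset ?inE ?upE ?downE ?tK //; apply: inv_inj tK.
have sum_count : count_mem Up P + count_mem Down P = 2 * n.
  rewrite -{3}(size_tuple P) -(count_predC (pred1 Up)); congr (_ + _).
  by apply: eq_count => -[].
rewrite inE; apply/and3P; split; [apply/eqP; lia..|].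
apply/forallP => -[k /= lt_k]; rewrite !count_take_card //.
(* For a down step [i < k], [t i] is an up step with [t i < i < k], so [t] injects the down steps of
   the prefix into its up steps. *)
rewrite -(card_imset _ (inv_inj tK)); apply: subset_leq_card.
apply/subsetP => _ /imsetP[i + ->]; rewrite !inE downE upE tK; lia.
Qed.

End InvolutionPath.

Lemma mem_sigma_prefix (n : nat) (s : 'S_(2 * n)) (k i : 'I_(2 * n)) :
  (i \in sigma_prefix s k) = ((s^-1)%g i <= k).
Proof.
by rewrite -{1}(permKV s i) (mem_imset _ _ (@perm_inj _ s)) inE.
Qed.

Theorem theorem1 (n : nat) (hn : 1 <= n) (s : 'S_(2 * n))
  (D : (2 * n).-tuple step) (hD : D \in Dyck n) : sigma_path s D \in Dyck n.
Proof.
apply: (@involution_path_Dyck n (fun k => (s^-1)%g (tunnel D (s k)))).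
- by move=> k; rewrite permKV tunnelK // permK.
- by move=> k; rewrite -{2}(permK s k) (inj_eq perm_inj) tunnel_neq.
(* The partner of [s k] is outside the prefix exactly when its index under [s] exceeds [k]. *)
- by move=> k; rewrite tnth_mktuple mem_sigma_prefix -ltnNge.
Qed.
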